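(* Let $k \ge 4$ be an integer and let $x,t$ be positive integers. If $F_{x,t}^{(k)}(n_0) = 0$ for some $n_0 \in \mathcal{D}_{x,t}^{(k)}$, then $n_0$ is the greatest element of $\mathcal{D}_{x,t}^{(k)}$.
   Context: Fix an integer $N_1 \ge 2$. For an integer $k \ge 4$ and positive integers $x,t$, define for natural numbers $n$ \[ F_{x,t}^{(k)}(n) = t^2(kx-n)^2 - 2nxt, \] and define the admissible domain of the pair $(x,t)$ by \[ \mathcal{D}_{x,t}^{(k)} = \left\{ n \in \mathbb{N},\ n \ge N_1 \ \middle|\ n < kx \ \text{and}\ t \ge \frac{2nx}{(kx-n)^2} \right\}. \] *)

(* Defs.v *)
From mathcomp Require Import all_boot all_order all_algebra.

Set Implicit Arguments.
Unset Strict Implicit.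
Unset Printing Implicit Defensive.

Import Order.TTheory GRing.Theory Num.Theory.
Local Open Scope ring_scope.

(* Integer-valued: both k x - n and the whole expression may be negative,
   so truncated subtraction on nat would be wrong. *)
Definition F (k x t n : nat) : int :=
  t%:Z ^+ 2 * (k%:Z * x%:Z - n%:Z) ^+ 2 - 2 * n%:Z * x%:Z * t%:Z.

(* The quotient is an exact rational division; the conjunct n < k x makes its
   denominator nonzero. *)
Definition admissible (N1 k x t : nat) : pred nat :=
  [pred n : nat | [&& (N1 <= n)%N, (n < k * x)%N
    & (2 * n%:R * x%:R) / (k%:R * x%:R - n%:R) ^+ 2 <= t%:R :> rat]].

Definition is_greatest (D : pred nat) (m : nat) : Prop :=
  m \in D /\ forall n : nat, n \in D -> (n <= m)%N.

(* Main.v *)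
Require Import Defs.
From mathcomp Require Import all_boot all_order all_algebra.

Import Order.TTheory GRing.Theory Num.Theory.
Local Open Scope ring_scope.

(** For [n < k x] the defining inequality reads [2 n x <= t (k x - n)^2].  Its
    left side grows and its right side shrinks with [n], and [F = 0] says that
    equality holds at [n0], so it fails for every larger [n]. *)

(* The subtraction of naturals is not truncated here, since [n < k * x]. *)
Lemma in_admissible (N1 k x t n : nat) :
  (n \in admissible N1 k x t) =
  [&& N1 <= n, n < k * x & 2 * n * x <= t * (k * x - n) ^ 2]%N.
Proof.
rewrite inE; case: (N1 <= n)%N => //=; case: (ltnP n (k * x)) => //= ltn_kx.
(* The denominator is a positive square, so clearing it leaves an inequality between casts of
   naturals. *)
rewrite -!natrM -(natrB _ (ltnW ltn_kx)) ler_pdivrMr; last first.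
  by rewrite exprn_gt0 // ltr0n subn_gt0.
by rewrite -natrX -!natrM ler_nat.
Qed.

(** One of the two factors [t] cancels because [t] is positive; [n <= k * x] turns the integer
    difference into a natural one. *)
Lemma F_eq0 {k x t n : nat} : (0 < t)%N -> (n <= k * x)%N ->
  F k x t n = 0 -> (t * (k * x - n) ^ 2 = 2 * n * x)%N.
Proof.
move=> t_gt0 len_kx /eqP; rewrite /F subr_eq0 -(PoszM k) subzn //.
rewrite -!natz -!natrX -!natrM eqr_nat => /eqP Ft.
by apply/eqP; rewrite -(eqn_pmul2r t_gt0) -Ft mulnAC mulnn.
Qed.

Theorem mainTheorem3 (N1 k x t : nat) (hN1 : (2 <= N1)%N) (hk : (4 <= k)%N)
    (hx : (0 < x)%N) (ht : (0 < t)%N) (n0 : nat)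
    (hn0 : n0 \in admissible N1 k x t) (hF : F k x t n0 = 0) :
  is_greatest (admissible N1 k x t) n0.
Proof.
split=> // n; rewrite in_admissible => /and3P[_ ltn_kx len].
have /and3P[_ ltn0_kx _] : [&& N1 <= n0, n0 < k * x
    & 2 * n0 * x <= t * (k * x - n0) ^ 2]%N by rewrite -in_admissible.
rewrite leqNgt; apply/negP => ltn0n.
(* Equality at [n0] is refuted by the chain [2 n0 x < 2 n x <= t (k x - n)^2 <= t (k x - n0)^2],
   whose strictness comes from [0 < x]. *)
have := F_eq0 ht (ltnW ltn0_kx) hF; apply/eqP; rewrite gtn_eqF //.
have lt1 : (2 * n0 * x < 2 * n * x)%N by rewrite ltn_pmul2r // ltn_pmul2l.
apply: leq_trans lt1 (leq_trans len _).
by rewrite leq_pmul2l // leq_exp2r // leq_sub2l // ltnW.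
Qed.
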